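(* Let $M$ be an $m\times n$ integer matrix and $N$ an $l\times n$ matrix with non-negative integer entries and columns $\mathbf b_1,\dots,\mathbf b_n$ (all columns nonzero), with $I_N\subseteq I_M$; let $\phi:K[x_1,\dots,x_n]\to K[t_1,\dots,t_l]$, $\phi(x_i)=\mathbf t^{\mathbf b_i}$, and assume $\Gamma(N)=V(I_N)$ in $\bar K^n$. Let $f_1,\dots,f_s$ be binomials in $I_M$, $J=(f_1,\dots,f_s)$, and $G=\langle \mathbf y_{\widehat{f_1}},\dots,\mathbf y_{\widehat{f_s}}\rangle\subseteq N(\ker_{\mathbb Z}(M))$. If $\mathrm{char}(K)=p\ne0$ (resp. $\mathrm{char}(K)=0$), then $I_M=\mathrm{rad}(I_N+J)$ if and only if (a) $p^kN(\ker_{\mathbb Z}(M))\subseteq G$ for some $k\in\mathbb N$ (resp. $N(\ker_{\mathbb Z}(M))=G$), and (b) $\mathrm{rad}((\phi(I_M))^e,t_i)=\mathrm{rad}(\phi(f_1),\dots,\phi(f_s),t_i)$ for all $i=1,\dots,l$.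
   Context: $K$ is a field with algebraic closure $\bar K$; $I_M$ is the toric ideal of $M$ (kernel of $x_i\mapsto\mathbf t^{\mathbf a_i}$, $\mathbf a_i$ the columns of $M$). $\Gamma(N)=\{(\mathbf T^{\mathbf b_1},\dots,\mathbf T^{\mathbf b_n}):\mathbf T\in\bar K^l\}$, $V(I_N)$ the zero set of $I_N$ in $\bar K^n$. For a binomial $f=\mathbf x^{\mathbf u}-\mathbf x^{\mathbf v}$, $\widehat f=\mathbf u-\mathbf v\in\mathbb Z^n$. $\mathbf y_{\mathbf u}=\sum u_i\mathbf b_i$ and $N(\ker_{\mathbb Z}(M))=\{\mathbf y_{\mathbf u}:\mathbf u\in\mathbb Z^n, M\mathbf u^T=0\}$. $(\phi(I_M))^e=\phi(I_M)K[t_1,\dots,t_l]$. *)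

(* Defs.v *)
From HB Require Import structures.
From mathcomp Require Import all_boot all_order all_algebra.
From mathcomp Require Import mpoly.
Set Implicit Arguments. Unset Strict Implicit. Unset Printing Implicit Defensive.
Import Order.TTheory GRing.Theory Num.Theory.
Local Open Scope ring_scope.

Definition ideal_gen (R : comNzRingType) (S : R -> Prop) : R -> Prop :=
  fun p => exists r : seq (R * R),
    (forall q, q \in r -> S q.2) /\ p = \sum_(q <- r) q.1 * q.2.

Definition radI (R : comNzRingType) (I : R -> Prop) : R -> Prop :=
  fun p => exists k : nat, I (p ^+ k).

Definition setU_P (R : Type) (A B : R -> Prop) : R -> Prop := fun p => A p \/ B p.

Definition same_set (R : Type) (A B : R -> Prop) : Prop := forall p, A p <-> B p.

Definition mexpZ (n : nat) (u : 'X_{1..n}) : 'cV[int]_n := \col_i ((u i)%:Z).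

(* Toric ideal I_M of an integer matrix M : the kernel of the K-algebra map
   K[x_1..x_n] -> K[t_1^{+-1},..,t_m^{+-1}], x_i |-> t^{a_i}.  The Laurent
   polynomial ring is the group algebra K[Z^m]; the image of f is
   sum_u f_u t^{M u}, which is zero iff for every w in Z^m the coefficients of
   the monomials u with M u = w sum to zero. *)
Definition toric_ideal (K : fieldType) (m n : nat) (M : 'M[int]_(m, n))
  : {mpoly K[n]} -> Prop :=
  fun f => forall w : 'cV[int]_m,
    \sum_(u <- msupp f | M *m mexpZ u == w) f@_u = 0.

Definition colmon (l n : nat) (N : 'M[int]_(l, n)) (i : 'I_n) : 'X_{1..l} :=
  [multinom absz (N j i) | j < l].

Definition phi (K : fieldType) (l n : nat) (N : 'M[int]_(l, n))
  (f : {mpoly K[n]}) : {mpoly K[l]} :=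
  f \mPo [tuple 'X_[colmon N i] | i < n].

Definition Gamma (L : fieldType) (l n : nat) (N : 'M[int]_(l, n))
  : ('I_n -> L) -> Prop :=
  fun v => exists T : 'I_l -> L, forall i, v i = \prod_(j < l) T j ^+ absz (N j i).

Definition zero_set (K L : fieldType) (iota : {rmorphism K -> L}) (n : nat)
  (I : {mpoly K[n]} -> Prop) : ('I_n -> L) -> Prop :=
  fun v => forall f, I f -> (map_mpoly iota f).@[v] = 0.

Definition binom (K : fieldType) (n : nat) (u v : 'X_{1..n}) : {mpoly K[n]} :=
  'X_[u] - 'X_[v].

Definition hatb (n : nat) (u v : 'X_{1..n}) : 'cV[int]_n := mexpZ u - mexpZ v.

Definition NkerM (l m n : nat) (M : 'M[int]_(m, n)) (N : 'M[int]_(l, n))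
  : 'cV[int]_l -> Prop :=
  fun y => exists u : 'cV[int]_n, M *m u = 0 /\ y = N *m u.

Definition Zspan (l s : nat) (g : 'I_s -> 'cV[int]_l) : 'cV[int]_l -> Prop :=
  fun y => exists c : 'I_s -> int, y = \sum_(k < s) c k *: g k.

(* Main.v *)
Require Import Defs.
From HB Require Import structures.
From mathcomp Require Import all_boot all_order all_algebra.
From mathcomp Require Import mpoly.
From mathcomp Require Import cyclic separable cyclotomic ring zify.
From mathcomp Require boolp classical_sets.
Set Implicit Arguments. Unset Strict Implicit. Unset Printing Implicit Defensive.
Import Order.TTheory GRing.Theory Num.Theory.
Local Open Scope ring_scope.

(** Let x(T) be the point (T^{b_1}, ..., T^{b_n}).  By the Nullstellensatz and
Gamma(N) = V(I_N), the equality I_M = rad(I_N + J) says that every T in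
\bar K^l at which all phi(f_k) vanish is a zero of phi(I_M).  For the T with
some T_i = 0 this is condition (b), again by the Nullstellensatz.  A T in the
torus is a character of Z^l: all phi(f_k) vanish at T iff it is trivial on G,
and phi(I_M) vanishes at T iff it is trivial on N(ker_Z M).  Smith normal form
reduces the study of the characters trivial on G to that of the roots of unity
of \bar K, which only miss the p-part of the orders: this gives (a).

The Nullstellensatz is proved for arbitrary (not finitely generated) ideals and
without change of coordinates: a prime ideal avoiding the powers of h comes from
Zorn's lemma, and points are extended one variable at a time, a polynomial of
least degree in the prime ideal playing the role of the minimal polynomial.
That I_M is a radical ideal follows from its being the vanishing ideal of the
points (S^{a_1}, ..., S^{a_n}) with S in the torus. *)

(** * Ideals, and primes avoiding the powers of an element *)

Record is_ideal (A : comNzRingType) (I : A -> Prop) : Prop := IsIdeal {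
  ideal0 : I 0;
  idealD : forall a b, I a -> I b -> I (a + b);
  idealMl : forall a b, I b -> I (a * b) }.

Record is_prime (A : comNzRingType) (P : A -> Prop) : Prop := IsPrime {
  prime_is_ideal : is_ideal P;
  prime_neq1 : ~ P 1;
  prime_mul : forall a b, P (a * b) -> P a \/ P b }.

Lemma idealB (A : comNzRingType) (I : A -> Prop) a b :
  is_ideal I -> I a -> I b -> I (a - b).
Proof.
by move=> idI Ia Ib; apply: idealD => //; rewrite -mulN1r; apply: idealMl.
Qed.

Lemma ideal_sum (A : comNzRingType) (I : A -> Prop) (J : eqType) (r : seq J)
  (F : J -> A) :
  is_ideal I -> (forall j, j \in r -> I (F j)) -> I (\sum_(j <- r) F j).
Proof.
move=> idI IF; rewrite big_seq; elim/big_ind: _ => //; first exact: ideal0.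
exact: idealD.
Qed.

Lemma prime_exp (A : comNzRingType) (P : A -> Prop) a k :
  is_prime P -> P (a ^+ k) -> P a.
Proof.
move=> prP; elim: k => [|k IH]; first by rewrite expr0 => /(prime_neq1 prP).
by rewrite exprS => /(prime_mul prP)[].
Qed.

Lemma ideal_gen_is_ideal (A : comNzRingType) (S : A -> Prop) :
  is_ideal (ideal_gen S).
Proof.
split.
- by exists [::]; rewrite big_nil.
- move=> _ _ [r [Sr ->]] [s [Ss ->]]; exists (r ++ s); rewrite big_cat.
  by split=> // q; rewrite mem_cat => /orP[/Sr|/Ss].
- move=> a _ [r [Sr ->]]; exists [seq (a * q.1, q.2) | q <- r]; split.
    by move=> _ /mapP[q /Sr Sq ->].
  by rewrite big_map mulr_sumr; apply: eq_bigr => q _; rewrite mulrA.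
Qed.

Lemma ideal_gen_incl (A : comNzRingType) (S : A -> Prop) a :
  S a -> ideal_gen S a.
Proof.
move=> Sa; exists [:: (1, a)]; rewrite big_seq1 mul1r; split=> // q.
by rewrite inE => /eqP->.
Qed.

Lemma ideal_gen_min (A : comNzRingType) (S I : A -> Prop) :
  is_ideal I -> (forall a, S a -> I a) -> forall a, ideal_gen S a -> I a.
Proof.
move=> idI SI _ [r [Sr ->]]; apply: ideal_sum => // q /Sr/SI.
exact: idealMl.
Qed.

Lemma ideal_gen_mono (A : comNzRingType) (S S' : A -> Prop) :
  (forall a, S a -> S' a) -> forall a, ideal_gen S a -> ideal_gen S' a.
Proof.
move=> SS'; apply: ideal_gen_min; first exact: ideal_gen_is_ideal.
by move=> a /SS'; apply: ideal_gen_incl.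
Qed.

(** The elements congruent to a multiple of [a] modulo the ideal of [S] form an ideal containing [S]
    and [a]. *)
Lemma ideal_gen_add1 (A : comNzRingType) (S : A -> Prop) a x :
  ideal_gen (setU_P S (eq^~ a)) x -> exists r, ideal_gen S (x - r * a).
Proof.
have idS := ideal_gen_is_ideal S.
move: x; apply: ideal_gen_min => [|x].
  split.
  - by exists 0; rewrite mul0r subr0; apply: ideal0.
  - move=> x y [r Sx] [s Sy]; exists (r + s).
    have -> : x + y - (r + s) * a = (x - r * a) + (y - s * a) by ring.
    exact: idealD.
  - move=> b x [r Sx]; exists (b * r).
    have -> : b * x - b * r * a = b * (x - r * a) by ring.
    exact: idealMl.
move=> [Sx|->]; last by exists 1; rewrite mul1r subrr; apply: ideal0.
by exists 0; rewrite mul0r subr0; apply: ideal_gen_incl.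
Qed.

Lemma exists_prime_avoiding (A : comNzRingType) (S : A -> Prop) (h : A) :
  ~ radI (ideal_gen S) h ->
  exists P, [/\ is_prime P, forall a, S a -> P a & ~ P h].
Proof.
move=> NSh.
(* S is kept outside of X so that the empty chain also has an upper bound. *)
pose C (X : A -> Prop) := ~ radI (ideal_gen (setU_P S X)) h.
have [] := @classical_sets.Zorn_bigcup A C.
  move=> F FC totF [k [r [Fr hk]]].
  (* A combination involves finitely many generators; along a chain, those outside [S] lie in a
     single member. *)
  have [[X FX Xr]|Sr] : (exists2 X, F X & forall q, q \in r -> setU_P S X q.2)
      \/ (forall q, q \in r -> S q.2).
  - elim: r {hk} Fr => [|q r IH] Fr; first by right.
    have {}IH := IH (fun q1 rq1 => Fr q1 (@mem_behead _ (q :: r) q1 rq1)).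
    have := Fr q (mem_head _ _); case=> [Sq|[X FX Xq]].
      case: IH => [[X FX Xr]|Sr].
        left; exists X => // q'; rewrite inE => /orP[/eqP->|/Xr//].
        by left.
      by right=> q'; rewrite inE => /orP[/eqP->|/Sr].
    left; case: IH => [[Y FY Yr]|Sr].
      have [XY|YX] := totF _ _ FX FY.
        exists Y => // q'; rewrite inE => /orP[/eqP->|/Yr//].
        by right; apply: XY.
      exists X => // q'; rewrite inE => /orP[/eqP->|/Yr]; first by right.
      by move=> [?|/YX ?]; [left|right].
    exists X => // q'; rewrite inE => /orP[/eqP->|/Sr ?]; last by left.
    by right.
  - by apply: (FC X FX); exists k, r.
  - by apply: NSh; exists k, r.
move=> X [CX maxX]; exists (ideal_gen (setU_P S X)).
have idX := ideal_gen_is_ideal (setU_P S X).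
(* By maximality, adjoining any [a] outside the ideal brings in a power of [h]. *)
have step a : ~ ideal_gen (setU_P S X) a ->
    exists k r, ideal_gen (setU_P S X) (h ^+ k - r * a).
  move=> NXa; pose Y := setU_P X (eq^~ a).
  have /boolp.contrapT [k] : ~ C Y.
    apply: maxX; split=> [b ? | YX]; first by left.
    by apply/NXa/ideal_gen_incl; right; apply: YX; right.
  move=> hk; exists k; apply: ideal_gen_add1; apply: ideal_gen_mono hk => b.
  by rewrite /setU_P /Y /setU_P; tauto.
split.
- split=> //.
    by move=> X1; apply: CX; exists 0%N; rewrite expr0.
  move=> a b Xab; case: (boolp.EM (ideal_gen (setU_P S X) a)); first by left.
  case: (boolp.EM (ideal_gen (setU_P S X) b)); first by right.
  (* Modulo the ideal two powers of [h] are [s * b] and [r * a], so their product is a multiple of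
     [a * b], that is 0. *)
  move=> /step[i [s Xb]] /step[j [r Xa]]; case: CX; exists (i + j)%N.
  have -> : h ^+ (i + j) = h ^+ i * (h ^+ j - r * a)
      + (r * a) * (h ^+ i - s * b) + (r * s) * (a * b) by rewrite exprD; ring.
  by do 2 ?apply: idealD => //; apply: idealMl.
- by move=> a Sa; apply: ideal_gen_incl; left.
- by move=> Xh; apply: CX; exists 1%N; rewrite expr1.
Qed.

(** * Univariate polynomials modulo an ideal of coefficients *)

(** [lead_coef e] may be a non-unit, hence the scaling by its powers. The bound on [q] serves the
    degree argument in [points_separate_poly]. *)
Lemma pseudo_division (A : comNzRingType) (e f : {poly A}) : e != 0 ->
  exists k q, (size (lead_coef e ^+ k *: f - q * e)%R < size e)%N
    /\ (size q <= (size f).+1 - size e)%N.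
Proof.
move=> e0; have [N] := ubnP (size f); elim: N f => // N IH f ltfN.
have [lt|le] := ltnP (size f) (size e).
  exists 0%N, 0; rewrite expr0 scale1r mul0r subr0 size_poly0.
  by split.
have se : (0 < size e)%N by rewrite size_poly_gt0.
set c := lead_coef e; pose d := (size f - size e)%N.
pose f' := c *: f - lead_coef f *: 'X^d * e.
have szf : (0 < size f)%N := leq_trans se le.
have ltf' : (size f' < size f)%N.
  rewrite -(prednK szf) ltnS; apply/leq_sizeP => i lei.
  rewrite coefB coefZ -scalerAl coefZ mulrC coefXnM.
  have -> : (i < d)%N = false.
    apply/negbTE; rewrite -leqNgt (leq_trans _ lei) // /d.
    by case: (size e) se => // ? _; lia.
  move: lei; rewrite leq_eqVlt => /orP[/eqP<-|lti].
    rewrite /c !lead_coefE.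
    have -> : ((size f).-1 - d = (size e).-1)%N by rewrite /d; lia.
    by rewrite subrr.
  rewrite !nth_default ?mul0r ?mulr0 ?subrr // /d; move: lti le se szf.
    by move: (size e) (size f) => se sf; lia.
  by case: (size f).
have [|k [q [szr szq]]] := IH f'; first by lia.
exists k.+1, (c ^+ k *: (lead_coef f *: 'X^d) + q); split.
  suff -> : c ^+ k.+1 *: f - (c ^+ k *: (lead_coef f *: 'X^d) + q) * e
      = c ^+ k *: f' - q * e by [].
  by rewrite /f' exprSr scalerBr mulrDl opprD addrA -!scalerAl !scalerA.
rewrite (leq_trans (size_polyD _ _)) // geq_max; apply/andP; split; last by lia.
do 2 rewrite (leq_trans (size_scale_leq _ _)) //; rewrite size_polyXn /d; lia.
Qed.

(** For an ideal [p] this is its extension to [{poly A}], the kernel of reduction modulo [p]. *)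
Definition coefs_in (A : comNzRingType) (p : A -> Prop) (f : {poly A}) : Prop :=
  forall i, p f`_i.

Lemma coefs_in_is_ideal (A : comNzRingType) (p : A -> Prop) :
  is_ideal p -> is_ideal (coefs_in p).
Proof.
move=> idp; split=> [i|f g pf pg i|f g pg i]; rewrite ?coef0 ?coefD ?coefM.
- exact: ideal0.
- exact: idealD.
- by apply: ideal_sum => // j _; apply: idealMl.
Qed.

Lemma is_prime_contraction (A : comNzRingType) (P : {poly A} -> Prop) :
  is_prime P -> is_prime (fun a => P a%:P).
Proof.
move=> [[P0 PD PM] P1 Pp]; split=> //.
- by split=> // a b *; rewrite ?polyCD ?polyCM; [apply: PD|apply: PM].
- by move=> a b; rewrite polyCM => /Pp.
Qed.

Lemma coefs_in_contraction (A : comNzRingType) (I : {poly A} -> Prop) f :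
  is_ideal I -> coefs_in (fun a => I a%:P) f -> I f.
Proof.
move=> idI If; rewrite -(coefK f) poly_def; apply: ideal_sum => // i _.
by rewrite -mul_polyC mulrC; apply: idealMl.
Qed.

(** When [p] is prime, this says that [I] becomes principal over the fraction field of A/p. A
    pseudo-remainder by an element of least size outside the extension of [p] is too short to lie
    outside it. *)
Lemma least_size_generator (A : comNzRingType) (p : A -> Prop)
  (I : {poly A} -> Prop) (f : {poly A}) :
  is_ideal p -> is_ideal I -> (forall g, coefs_in p g -> I g) ->
  I f -> ~ coefs_in p f ->
  exists e, [/\ I e, ~ p (lead_coef e) & forall g, I g ->
    exists k q, coefs_in p (lead_coef e ^+ k *: g - q * e)
      /\ (size q <= (size g).+1 - size e)%N].
Proof.
move=> idp idI pI If pf.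
have idQ := coefs_in_is_ideal idp.
have [e [Ie pe mine]] : exists e, [/\ I e, ~ coefs_in p e &
    forall g, I g -> (size g < size e)%N -> coefs_in p g].
  have [N] := ubnP (size f); elim: N f If pf => // N IH f If pf ltf.
  have [|nmin] := boolp.EM
      (exists g, [/\ I g, ~ coefs_in p g & (size g < size f)%N]).
    by case=> g [Ig pg ltg]; apply: (IH g) => //; apply: leq_trans ltg _.
  exists f; split=> // g Ig ltg; apply: boolp.contrapT => pg.
  by apply: nmin; exists g.
have e0 : e != 0.
  by apply/eqP=> e0; apply: pe; rewrite e0; apply: ideal0.
exists e; split=> //; last first.
  move=> g Ig; have [k [q [szr szq]]] := pseudo_division g e0.
  exists k, q; split=> //; apply: mine => //.
  by rewrite -mul_polyC; apply: idealB => //; apply: idealMl.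
(* Were the leading coefficient in [p], dropping the leading term would leave a shorter element of
   [I]; minimality puts it in the extension of [p], and [e] with it. *)
move=> ple; apply: pe.
pose d := (size e).-1; pose t := lead_coef e *: 'X^d : {poly A}.
have pt : coefs_in p t.
  move=> i; rewrite /t coefZ coefXn; case: (i == _); last first.
    by rewrite mulr0; apply: ideal0.
  by rewrite mulr1.
rewrite -(subrK t e); apply: (idealD idQ _ pt); apply: mine.
  by apply: idealB => //; apply: pI.
have se : (0 < size e)%N by rewrite size_poly_gt0.
rewrite -(prednK se) ltnS.
apply/leq_sizeP => i; rewrite coefB coefZ coefXn leq_eqVlt => /orP[/eqP<-|lti].
  by rewrite eqxx mulr1 lead_coefE subrr.
by rewrite gtn_eqF // mulr0 subr0 nth_default //; case: (size e) lti.
Qed.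

(** * Extending points by one variable *)

Section Points.
Variables (K : fieldType) (L : closedFieldType) (iota : {rmorphism K -> L}).

(** The form of the Nullstellensatz that passes from [A] to [{poly A}]. *)
Definition points_separate (A : comNzRingType) (c : K -> A) : Prop :=
  forall (P : A -> Prop) (h : A), is_prime P -> ~ P h ->
  exists ev : {rmorphism A -> L},
    [/\ forall x, ev (c x) = iota x, forall f, P f -> ev f = 0 & ev h != 0].

(** A point of [A] is extended by a value [b] of the variable: a non-root of [h] if [P] is extended
    from [A], otherwise a root of the minimal polynomial [g]. *)
Lemma points_separate_poly (A : comNzRingType) (c : K -> A) :
  points_separate c -> points_separate (fun x => (c x)%:P).
Proof.
move=> sepA P h prP Ph.
pose p a := P a%:P; have prp : is_prime p := is_prime_contraction prP.
have idP := prime_is_ideal prP; have idp := prime_is_ideal prp.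
have idQ := coefs_in_is_ideal idp.
have QP f : coefs_in p f -> P f by exact: coefs_in_contraction.
pose evp (ev : {rmorphism A -> L}) b : {rmorphism {poly A} -> L} :=
  horner_eval b \o map_poly ev.
have evpE ev b f : evp ev b f = (map_poly ev f).[b] by [].
have evpQ (ev : {rmorphism A -> L}) b f :
    (forall a, p a -> ev a = 0) -> coefs_in p f -> evp ev b f = 0.
  move=> evp0 Qf; rewrite evpE (_ : map_poly ev f = 0) ?horner0 //.
  by apply/polyP => i; rewrite coef_map coef0 /= evp0.
have evpC (ev : {rmorphism A -> L}) b a : evp ev b a%:P = ev a.
  by rewrite evpE map_polyC hornerC.
have [allQ|] := boolp.EM (forall f, P f -> coefs_in p f).
  have [i pi] : exists i, ~ p h`_i.
    by apply/boolp.existsNP => /QP.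
  have [ev [evc ev0 evh]] := sepA p _ prp pi.
  have hev0 : map_poly ev h != 0.
    by apply/eqP => /polyP/(_ i); rewrite coef_map coef0 /=; apply/eqP.
  have /closed_nonrootP [b hb] := hev0.
  exists (evp ev b); split=> // [x|f Pf]; first by rewrite evpC.
  exact/evpQ/allQ.
move=> /boolp.existsNP[g0 /boolp.not_implyP[Pg0 Qg0]].
have [g [Pg pg genP]] := least_size_generator idp idP QP Pg0 Qg0.
(* The ideal P + (h). A constant outside [p] found in it will force [h] to be nonzero at the new
   point. *)
pose I2 x := exists w, P (x - w * h).
have PI2 x : P x -> I2 x by exists 0; rewrite mul0r subr0.
have idI2 : is_ideal I2.
  split; first exact: PI2 (ideal0 idP).
  - move=> x y [r Px] [s Py]; exists (r + s).
    have -> : x + y - (r + s) * h = (x - r * h) + (y - s * h) by ring.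
    exact: idealD.
  - move=> b x [r Px]; exists (b * r).
    have -> : b * x - b * r * h = b * (x - r * h) by ring.
    exact: idealMl.
have I2h : I2 h by exists 1; rewrite mul1r subrr; apply: ideal0.
(* Modulo P, e is a gcd of g and h, hence a constant since g has least degree. *)
have [e [I2e pe genI2]] := least_size_generator idp idI2
  (fun f Qf => PI2 _ (QP f Qf)) I2h (fun Qh => Ph (QP h Qh)).
have NPC a k f : ~ p a -> P (a ^+ k *: f) -> P f.
  move=> pa; rewrite -mul_polyC polyC_exp => /(prime_mul prP)[|//].
  by move/(prime_exp prP).
have Pe : ~ P e.
  move=> Pe; apply: Ph; have [k [q [Qr _]]] := genI2 h I2h.
  apply: (NPC (lead_coef e) k) => //; rewrite -(subrK (q * e) (_ *: h)).
  by apply: (idealD idP (QP _ Qr)); apply: idealMl.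
have e0 : e != 0 by apply/eqP => e0; apply: Pe; rewrite e0; apply: ideal0.
have sze : size e = 1%N.
  apply/eqP; rewrite eqn_leq size_poly_gt0 e0 andbT leqNgt; apply/negP => gt1.
  have [k [q [Qr szq]]] := genI2 g (PI2 _ Pg).
  have [Pq|//] : P q \/ P e.
    apply: (prime_mul prP).
    rewrite -[q * e](subKr (lead_coef e ^+ k *: g)).
    by apply: (idealB idP _ (QP _ Qr)); rewrite -mul_polyC; apply: idealMl.
  have szg : (0 < size g)%N.
    rewrite size_poly_gt0; apply/eqP => gz; apply: pg.
    by rewrite gz lead_coef0; apply: ideal0 idp.
  (* [q] lies in [P] and is shorter than [g], because [size e] is at least 2; so its pseudo-division
     by [g] has quotient 0. *)
  have Qq : coefs_in p q.
    have [j [t [Qt szt]]] := genP q Pq.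
    have t0 : t = 0.
      apply/eqP; rewrite -size_poly_eq0.
      move: szt szq szg gt1.
      move: (size t) (size q) (size g) (size e) => a1 a2 a3 a4; lia.
    move=> i; have := Qt i; rewrite t0 mul0r subr0 coefZ => /(prime_mul prp)[|//].
    by move/(prime_exp prp).
  have /(_ (size g).-1) : coefs_in p (lead_coef e ^+ k *: g).
    rewrite -(subrK (q * e) (_ *: g)); apply: (idealD idQ) => //.
    by rewrite mulrC; apply: (idealMl idQ).
  rewrite coefZ -lead_coefE => /(prime_mul prp)[/(prime_exp prp)//|//].
have eC : e = (lead_coef e)%:P by rewrite {1}(size1_polyC (eq_leq sze)) lead_coefE sze.
(* The leading coefficient of [g] must survive so that [g] keeps a root and pseudo-division by it
   can be cancelled, that of [e] so that the constant [e] stays nonzero. *)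
have [ev [evc ev0 evge]] := sepA p (lead_coef g * lead_coef e) prp
  (fun pge => match prime_mul prp pge with or_introl a => pg a | or_intror b => pe b end).
rewrite rmorphM mulf_eq0 negb_or in evge; case/andP: evge => evg eve.
have [b gb] : exists b, root (map_poly ev g) b.
  apply/closed_rootP; rewrite size_map_poly_id0 //; apply/eqP => sg1.
  apply: pg; rewrite /p lead_coefE sg1 -size1_polyC ?sg1 //.
exists (evp ev b).
have evP f : P f -> evp ev b f = 0.
  move=> Pf; have [k [q [Qr _]]] := genP f Pf.
  have := evpQ ev b _ ev0 Qr; rewrite rmorphB rmorphM -mul_polyC rmorphM evpC.
  rewrite [evp ev b g]evpE (rootP gb) mulr0 subr0 rmorphXn => /eqP.
  by rewrite mulf_eq0 expf_eq0 (negbTE evg) andbF => /eqP.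
split=> // [x|]; first by rewrite evpC.
(* [e] is [w * h] modulo [P], so [h] cannot vanish where [e] does not. *)
have [w Pw] := I2e; have := evP _ Pw; rewrite rmorphB rmorphM eC evpC.
move=> /eqP; rewrite subr_eq0; apply: contraL => /eqP ->.
by rewrite mulr0.
Qed.
End Points.

(** * The Nullstellensatz in several variables *)

Lemma muniK (R : comNzRingType) n (f : {mpoly R[n.+1]}) :
  (mpwiden (muni f)).['X_ord_max] = f.
Proof.
rewrite muniE [in RHS](mpolyE f).
pose tau : {rmorphism {poly {mpoly R[n]}} -> {mpoly R[n.+1]}} :=
  horner_eval 'X_ord_max \o map_poly (@mwiden n R).
rewrite -[LHS]/(tau _) rmorph_sum; apply: eq_bigr => m _.
rewrite -mul_mpolyC -mul_polyC !rmorphM /= /horner_eval !map_polyC !hornerC /=.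
rewrite mwidenC mwidenX map_polyXn hornerXn -mul_mpolyC -mulrA; congr (_ * _).
rewrite [in RHS]mpolyXE_id big_ord_recr mpolyXE_id big_ord_recr /=.
rewrite mnmwiden_ordmax expr0 mulr1; congr (_ * _).
by apply: eq_bigr => i _; rewrite mnmwiden_widen mnmE.
Qed.

Section Nullstellensatz.
Variables (K : fieldType) (L : closedFieldType) (iota : {rmorphism K -> L}).

Lemma rmorph_mpolyE (A : comNzRingType) n (ev : {rmorphism {mpoly K[n]} -> A})
  (f : {mpoly K[n]}) :
  ev f = mmap (ev \o @mpolyC n K) (fun i => ev 'X_i) f.
Proof.
rewrite [in LHS](mpolyE f) rmorph_sum; apply: eq_bigr => m _.
rewrite -mul_mpolyC rmorphM /= mpolyXE_id rmorph_prod; congr (_ * _).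
by apply: eq_bigr => i _; rewrite rmorphXn.
Qed.

Lemma points_separate_mpoly n : points_separate iota (@mpolyC n K).
Proof.
elim: n => [|n IH].
  (* Without variables the ring is [K], whose only prime ideal is 0. *)
  move=> P h [idP P1 _] Ph; exists (mmap iota (fun _ => 0)).
  have E (f : {mpoly K[0]}) : f = (f@_0)%:MP.
    by apply/mpolyP => m; rewrite mcoeffC (_ : m = 0%MM) ?eqxx ?mulr1 //;
      apply/mnmP => -[].
  have P0 f : P f -> f = 0.
    move=> Pf; apply/eqP; apply: boolp.contrapT => /negP f0; apply: P1.
    have c0 : f@_0 != 0 by apply: contraNneq f0 => c0; rewrite [f]E c0.
    rewrite -[1](_ : (f@_0)^-1%:MP * f = 1); first exact: idealMl.
    by rewrite {2}[f]E -mpolyCM mulVf.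
  have mC x : mmap iota (fun _ : 'I_0 => 0) x%:MP = iota x by exact: mmapC.
  split=> [x|f /P0 ->|]; [exact: mC|exact: rmorph0|].
  rewrite [h]E -[X in X != _]/(mmap _ _ _) mC fmorph_eq0.
  apply: contra_notN Ph => /eqP h0.
  by rewrite [h]E h0 mpolyC0; apply: ideal0.
move=> P h [idP P1 Pp] Ph.
pose tau : {rmorphism {poly {mpoly K[n]}} -> {mpoly K[n.+1]}} :=
  horner_eval 'X_ord_max \o map_poly (@mwiden n K).
have tauK f : tau (muni f) = f by exact: muniK.
have [||ev [evc ev0 evh]] := points_separate_poly IH
    (P := fun f => P (tau f)) (h := muni h).
- split; [split| |] => [|a b|a b||a b].
  + by rewrite rmorph0; apply: ideal0.
  + by rewrite rmorphD; apply: idealD.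
  + by rewrite rmorphM; apply: idealMl.
  + by rewrite rmorph1.
  + by rewrite rmorphM => /Pp.
- by rewrite tauK.
exists (ev \o @muni n K); split=> [x|f Pf|//] /=.
  by rewrite muniC evc.
by apply: ev0; rewrite tauK.
Qed.

Theorem nullstellensatz n (S : {mpoly K[n]} -> Prop) (h : {mpoly K[n]}) :
  (forall v, (forall f, S f -> mmap iota v f = 0) -> mmap iota v h = 0) ->
  radI (ideal_gen S) h.
Proof.
move=> vanish; apply: boolp.contrapT => /exists_prime_avoiding[P [prP SP Ph]].
have [ev [evc ev0 /eqP evh]] := points_separate_mpoly prP Ph.
have evE f : ev f = mmap iota (fun i => ev 'X_i) f.
  by rewrite rmorph_mpolyE; apply: eq_bigr => m _ /=; rewrite evc.
by apply: evh; rewrite evE; apply: vanish => f /SP/ev0; rewrite evE.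
Qed.

(** The Nullstellensatz without equations: in a domain the radical of 0 is 0. *)
Lemma exists_nonzero_point n (h : {mpoly K[n]}) :
  h != 0 -> exists v, mmap iota v h != 0.
Proof.
move=> h0; apply: boolp.contrapT => /boolp.forallNP h_vanish.
have [|k] := @nullstellensatz n (fun _ => False) h.
  by move=> v _; apply/eqP/negPn/negP/h_vanish.
case=> r [r0]; rewrite big_seq big1 => [|q /r0 //].
by apply/eqP; rewrite expf_eq0 (negbTE h0) andbF.
Qed.
End Nullstellensatz.

(** * Points of the torus as characters of Z^l *)

Definition tpow (F : fieldType) (l : nat) (T : 'I_l -> F) (y : 'cV[int]_l) : F :=
  \prod_(j < l) T j ^ y j 0.

Section Characters.
Variables (F : fieldType) (l : nat) (T : 'I_l -> F).
Hypothesis T_neq0 : forall j, T j != 0.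

Lemma tpow_neq0 y : tpow T y != 0.
Proof. by apply/prodf_neq0 => j _; rewrite expfz_neq0. Qed.

Lemma tpow0 : tpow T 0 = 1.
Proof. by rewrite /tpow big1 // => j _; rewrite mxE. Qed.

Lemma tpowD y z : tpow T (y + z) = tpow T y * tpow T z.
Proof.
by rewrite -big_split; apply: eq_bigr => j _ /=; rewrite mxE expfzDr.
Qed.

Lemma tpowZ a y : tpow T (a *: y) = tpow T y ^ a.
Proof.
rewrite /tpow (big_morph (fun x => x ^ a) (fun x y => expfzMl x y a) (exp1rz _ a)).
by apply: eq_bigr => j _; rewrite mxE mulrC exprz_exp.
Qed.

Lemma tpowN y : tpow T (- y) = (tpow T y)^-1.
Proof. by rewrite -scaleN1r tpowZ -invr_expz. Qed.

Lemma tpow_sum (I : finType) (y : I -> 'cV[int]_l) :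
  tpow T (\sum_i y i) = \prod_i tpow T (y i).
Proof. exact: (big_morph _ tpowD tpow0). Qed.

Lemma tpow_mul n (A : 'M[int]_(l, n)) (z : 'cV[int]_n) :
  tpow T (A *m z) = tpow (fun i => tpow T (col i A)) z.
Proof.
have -> : A *m z = \sum_i z i 0 *: col i A.
  apply/colP => j; rewrite mxE summxE; apply: eq_bigr => i _.
  by rewrite !mxE mulrC.
by rewrite tpow_sum; apply: eq_bigr => i _; rewrite tpowZ.
Qed.

Lemma tpow_mexpZ (w : 'X_{1..l}) : tpow T (mexpZ w) = \prod_j T j ^+ w j.
Proof. by apply: eq_bigr => j _; rewrite mxE. Qed.

End Characters.

(** * Roots of unity and duality for subgroups of Z^l *)

Section RootsOfUnity.
Variable L : closedFieldType.

(** X^d - 1 is separable because d is nonzero in [L], so it has d distinct roots. *)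
Lemma exists_prim_root d : d%:R != 0 :> L -> exists z : L, d.-primitive_root z.
Proof.
move=> d_neq0; have d_gt0 : (0 < d)%N.
  by rewrite lt0n; apply: contraNneq d_neq0 => ->.
have [r Dr] := closed_field_poly_normal ('X^d - 1 : {poly L}).
rewrite lead_coefXnsubC // scale1r in Dr.
have [] : exists2 z, z \in r & d.-primitive_root z; last by move=> z; exists z.
apply/hasP; apply: has_prim_root => //.
- apply/allP => z; rewrite -root_prod_XsubC -Dr.
  by rewrite unity_rootE /root !hornerE subr_eq0.
- by rewrite -separable_prod_XsubC -Dr separable_Xn_sub_1.
- by rewrite -ltnS -(size_prod_XsubC r id) -Dr size_XnsubC.
Qed.

Lemma exists_nonroot_of_unity d : (0 < d)%N ->
  exists2 z : L, z != 0 & z ^+ d != 1.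
Proof.
move=> d_gt0; have /closed_nonrootP[z] : 'X * ('X^d - 1) != 0 :> {poly L}.
  by rewrite mulf_neq0 ?polyX_eq0 // -size_poly_eq0 size_XnsubC.
rewrite rootM negb_or /root !hornerE => /andP[z0 zd]; exists z => //.
by rewrite -subr_eq0.
Qed.

Lemma exprz_eq1_abs (x : L) (z : int) : x ^ z = 1 <-> x ^+ `|z| = 1.
Proof.
case: z => n; first by [].
rewrite NegzE abszN -invr_expz -exprnP absz_nat; split=> [/eqP|->]; last by rewrite invr1.
by rewrite invr_eq1 => /eqP.
Qed.

Lemma exprz_dual0 (z : int) : (forall x : L, x != 0 -> x ^ z = 1) -> z = 0.
Proof.
move=> z1; apply/eqP; rewrite -absz_eq0 -leqn0 leqNgt; apply/negP.
by move=> /exists_nonroot_of_unity[x /z1/exprz_eq1_abs-> /eqP].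
Qed.

(** It is enough to test points with at most one coordinate other than 1. *)
Lemma tpow_dual0 l (y : 'cV[int]_l) :
  (forall T : 'I_l -> L, (forall j, T j != 0) -> tpow T y = 1) -> y = 0.
Proof.
move=> y1; apply/colP => j; rewrite mxE; apply: exprz_dual0 => x x0.
have := y1 (fun i => if i == j then x else 1) _.
rewrite /tpow (bigD1 j) //= eqxx big1 ?mulr1 => [|i /negbTE->]; last exact: exp1rz.
by apply=> i; case: ifP => // _; apply: oner_neq0.
Qed.

(* e is the characteristic exponent of L: p in characteristic p, and 1 in
characteristic 0. *)
Variable e : nat.
Hypothesis e_part : forall d, (0 < d)%N ->
  exists k d', d = (e ^ k * d')%N /\ d'%:R != 0 :> L.

(** The rank-one case. The test point is a primitive root of unity whose order is the factor [d'] of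
    [d] that is nonzero in [L]; [k] depends on [d] alone. *)
Lemma exprz_dual (d : int) : exists k, forall z : int,
  (forall x : L, x != 0 -> x ^ d = 1 -> x ^ z = 1) ->
  exists c, (e ^ k)%:Z * z = d * c.
Proof.
have [->|d0] := eqVneq d 0.
  exists 0%N => z z1; exists 0; rewrite (_ : z = 0) ?mulr0 //.
  by apply: exprz_dual0 => x x0; apply: z1.
have [|k [d' [Dd d'0]]] := @e_part `|d|%N; first by rewrite absz_gt0.
exists k => z z1; have [x prx] := exists_prim_root d'0.
suff /dvdzP[c ->] : (d %| (e ^ k)%:Z * z)%Z by exists c; rewrite mulrC.
rewrite dvdzE abszM Dd dvdn_mul // (prim_order_dvd prx); apply/eqP.
apply/exprz_eq1_abs/z1.
  by rewrite (prim_root_eq0 prx); apply: contraNneq d'0 => ->.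
by apply/exprz_eq1_abs; rewrite Dd mulnC exprM (prim_expr_order prx) expr1n.
Qed.

(** The Smith form is rectangular: [insub] turns a row index below [s] into a column index, and the
    remaining rows are 0. *)
Lemma smith_diag_mul l s r (d : seq int) (W : 'M[int]_(s, r)) i k :
  (\matrix_(i < l, j < s) (d`_i *+ (i == j :> nat)) *m W) i k
  = (if (i < s)%N then d`_i else 0) * oapp (W^~ k) 0 (insub (i : nat)).
Proof.
rewrite mxE; case: insubP => [j -> Dj|nis] /=.
  rewrite (bigD1 j) //= big1 ?addr0 => [|a /negbTE ja].
    by rewrite mxE Dj eqxx mulr1n.
  by rewrite mxE -Dj eq_sym [_ == _]ja mul0r.
rewrite (negbTE nis) mul0r big1 // => a _; rewrite mxE gtn_eqF ?mul0r //.
by apply: leq_trans (ltn_ord a) _; rewrite leqNgt.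
Qed.

(** In coordinates adapted to the Smith form of [B] the claim splits into rank-one cases; the sum of
    their exponents serves all of them. *)
Lemma tpow_dual l s (B : 'M[int]_(l, s)) : exists k, forall y : 'cV[int]_l,
  (forall T : 'I_l -> L, (forall j, T j != 0) ->
    (forall i, tpow T (col i B) = 1) -> tpow T y = 1) ->
  exists c, (e ^ k)%:Z *: y = B *m c.
Proof.
have [P uP [Q uQ [d _ DB]]] := int_Smith_normal_form B.
pose dl (i : 'I_l) : int := if (i < s)%N then d`_i else 0.
have [k kP] := boolp.choice (fun i : 'I_l => exprz_dual (dl i)).
exists (\sum_i k i)%N => y y1; pose z := invmx P *m y.
have zP i : exists c, (e ^ (\sum_i k i))%:Z * z i 0 = dl i * c.
  have [|c Dc] := kP i (z i 0).
    (* The characters that only see the i-th Smith coordinate. *)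
    move=> x x0 xd; pose T (j : 'I_l) := x ^ (invmx P i j).
    have tT w : tpow T w = x ^ ((invmx P *m w) i 0).
      rewrite mxE (big_morph (exprz x) (fun m n => expfzDr m n x0) (expr0z x)).
      by apply: eq_bigr => j _; rewrite exprz_exp.
    rewrite -tT; apply: y1 => [j|j]; first exact: expfz_neq0.
    rewrite tT colE mulmxA -colE DB -mulmxA mulKmx // mxE smith_diag_mul.
    by rewrite -exprz_exp xd exp1rz.
  exists ((e ^ (\sum_(a | a != i) k a))%:Z * c).
  by rewrite (bigD1 i) //= expnD PoszM mulrAC Dc -mulrA [c * _]mulrC.
have [c cP] := boolp.choice zP.
(* Coordinates of index at least [l] meet no diagonal entry and are set to 0. *)
exists (invmx Q *m \col_(j < s) oapp c 0 (insub (j : nat))).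
rewrite DB -mulmxA mulKVmx // -[y](mulKVmx uP) -/z scalemxAr -mulmxA.
congr (_ *m _); apply/colP => i; rewrite mxE cP smith_diag_mul /dl.
case: insubP => [j -> Dj|/negbTE->]; last by rewrite !mul0r.
by rewrite /= mxE Dj valK.
Qed.

End RootsOfUnity.

(** * Toric ideals as vanishing ideals of torus points *)

Lemma big_seq_fibers (V : zmodType) (I J : eqType) (r : seq I) (g : I -> J)
  (F : I -> V) :
  \sum_(i <- r) F i = \sum_(j <- undup (map g r)) \sum_(i <- r | g i == j) F i.
Proof.
rewrite (exchange_big_dep xpredT) //= big_seq [RHS]big_seq.
apply: eq_bigr => i ri; rewrite -big_filter.
rewrite (perm_big [:: g i]) ?big_seq1 //; apply: uniq_perm => //.
  by rewrite filter_uniq ?undup_uniq.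
move=> j; rewrite mem_filter mem_undup inE eq_sym.
by have [<-|//] := eqVneq (g i) j; rewrite map_f.
Qed.

Section Toric.
Variables (K : fieldType) (L : closedFieldType) (iota : {rmorphism K -> L}).
Variables (m n : nat) (M : 'M[int]_(m, n)).

(** On each fibre of u -> M u, [c] is constant and the coefficients of [f] sum to 0. *)
Lemma toric_ideal_sum0 (f : {mpoly K[n]}) (c : 'X_{1..n} -> L) :
  toric_ideal M f ->
  (forall u v, M *m mexpZ u = M *m mexpZ v -> c u = c v) ->
  \sum_(u <- msupp f) iota f@_u * c u = 0.
Proof.
move=> Mf cM; rewrite (big_seq_fibers _ (fun u => M *m mexpZ u)).
rewrite big_seq big1 // => w; rewrite mem_undup => /mapP[u0 _ ->].
rewrite (eq_bigr (fun u => iota f@_u * c u0)) => [|u /eqP/cM-> //].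
by rewrite -mulr_suml -rmorph_sum Mf rmorph0 mul0r.
Qed.

Lemma mmap_monomials (T : 'I_n -> L) (f : {mpoly K[n]}) :
  mmap iota T f = \sum_(u <- msupp f) iota f@_u * \prod_i T i ^+ u i.
Proof. by []. Qed.

Lemma mmap_torus (T : 'I_m -> L) (f : {mpoly K[n]}) : (forall j, T j != 0) ->
  mmap iota (fun i => tpow T (col i M)) f =
  \sum_(u <- msupp f) iota f@_u * tpow T (M *m mexpZ u).
Proof.
move=> T0; rewrite mmap_monomials; apply: eq_bigr => u _.
by rewrite tpow_mul // tpow_mexpZ.
Qed.

(** The converse amounts to a Laurent polynomial being 0 once it vanishes on the torus over [L]. *)
Lemma toric_idealP (f : {mpoly K[n]}) : toric_ideal M f <->
  forall T : 'I_m -> L, (forall j, T j != 0) ->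
    mmap iota (fun i => tpow T (col i M)) f = 0.
Proof.
split=> [Mf T T0 | f0 w].
  by rewrite mmap_torus //; apply: toric_ideal_sum0 => // u v ->.
have [c cP] : exists c : nat, forall u j, u \in msupp f ->
    0 <= (M *m mexpZ u) j 0 + c%:Z.
  (* The sum of the absolute values of all exponents bounds each of them. *)
  exists (\sum_(u <- msupp f) \sum_j `|(M *m mexpZ u)%R j 0%R|)%N => u j uf.
  rewrite (big_rem u) //= (bigD1 j) //=.
  move: ((M *m mexpZ u) j 0) => z; lia.
(* Multiplying the image of f by t^(c, ..., c) clears the denominators. *)
pose sh (y : 'cV[int]_m) := [multinom absz (y j 0 + c%:Z)%R | j < m].
have shE (T : 'I_m -> L) u : (forall j, T j != 0) -> u \in msupp f ->
    \prod_j T j ^+ sh (M *m mexpZ u) j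
    = tpow T (M *m mexpZ u) * tpow T (const_mx c%:Z).
  move=> T0 uf; rewrite -tpowD //; apply: eq_bigr => j _.
  rewrite mnmE [in RHS]mxE [const_mx _ _ _]mxE.
  by rewrite -[in RHS](gez0_abs (cP u j uf)).
pose F : {mpoly K[m]} := \sum_(u <- msupp f) f@_u *: 'X_[sh (M *m mexpZ u)].
have F_torus T : (forall j, T j != 0) -> mmap iota T F = 0.
  move=> T0; rewrite rmorph_sum /=.
  have E := congr1 ( *%R^~ (tpow T (const_mx c%:Z))) (f0 T T0).
  rewrite mul0r mmap_torus // mulr_suml in E.
  rewrite -[RHS]E big_seq [RHS]big_seq.
  apply: eq_bigr => u uf; rewrite mmapZ -mulrA -shE //; congr (_ * _).
  exact: mmapX.
have F0 : F = 0.
  apply/eqP; apply: contraT => F_neq0.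
  (* A point where this product is nonzero lies in the torus, where [F] vanishes. *)
  have FX0 : F * \prod_j 'X_j != 0.
    by rewrite mulf_neq0 //; apply/prodf_neq0 => j _; rewrite -msupp_eq0 msuppX.
  have [T] := exists_nonzero_point iota FX0.
  rewrite rmorphM rmorph_prod mulf_eq0 negb_or => /andP[/eqP FT /prodf_neq0 T0].
  case: FT; apply: F_torus => j.
  have <- : mmap iota T 'X_j = T j by rewrite mmapX mmap1U.
  exact: T0.
(* Because of [absz], [sh] is known to be injective only on the exponents M u occurring in [f]; for
   any other [w] the sum is empty. *)
have [uf|nf] := boolP (has (fun u => M *m mexpZ u == w) (msupp f)); last first.
  rewrite big_seq_cond big1 // => u /andP[uf uw].
  by case/hasP: nf; exists u.
case/hasP: uf => u0 u0f /eqP Dw.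
have := congr1 (fun g : {mpoly K[m]} => g@_(sh w)) F0.
rewrite mcoeff0 raddf_sum => E0; rewrite -[RHS]E0 big_mkcond big_seq [RHS]big_seq.
apply: eq_bigr => u uf /=; rewrite mcoeffZ mcoeffX.
have [->|neq_w] := eqVneq (M *m mexpZ u) w; first by rewrite eqxx mulr1.
case: eqP => [/mnmP shw|]; last by rewrite mulr0.
case/eqP: neq_w; apply/colP => j; apply: (addIr c%:Z).
rewrite -[LHS]gez0_abs ?cP // -[RHS]gez0_abs; last by rewrite -Dw cP.
by have := shw j; rewrite !mnmE => ->.
Qed.
End Toric.

(** * Radicals, zero sets and the map phi *)

Section ZeroSets.
Variables (K : fieldType) (L : closedFieldType) (iota : {rmorphism K -> L}).

Definition vanishes (n : nat) (v : 'I_n -> L) (S : {mpoly K[n]} -> Prop) : Prop :=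
  forall f, S f -> mmap iota v f = 0.

Lemma radI_vanishes n (v : 'I_n -> L) (S : {mpoly K[n]} -> Prop) :
  vanishes v S -> vanishes v (radI (ideal_gen S)).
Proof.
move=> Sv h [k hk]; apply/eqP; suff: mmap iota v h ^+ k == 0.
  by rewrite expf_eq0 => /andP[].
rewrite -rmorphXn; apply/eqP; move: hk.
apply: (@ideal_gen_min _ S (fun f => mmap iota v f = 0)) => //.
split=> [|a b av bv|a b bv]; first exact: rmorph0.
  by rewrite rmorphD /= av bv addr0.
by rewrite rmorphM /= bv mulr0.
Qed.

Lemma radI_gen_sub n (S S' : {mpoly K[n]} -> Prop) :
  (forall v, vanishes v S -> vanishes v S') ->
  forall h, radI (ideal_gen S') h -> radI (ideal_gen S) h.
Proof.
move=> SS' h S'h; apply: (@nullstellensatz _ L iota) => v Sv.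
by apply: radI_vanishes S'h; apply: SS'.
Qed.

Lemma meval_map_mpoly n (v : 'I_n -> L) (f : {mpoly K[n]}) :
  (map_mpoly iota f).@[v] = mmap iota v f.
Proof.
rewrite -[LHS]/((meval v \o map_mpoly iota) f) [LHS]rmorph_mpolyE.
apply: eq_bigr => u _ /=; rewrite map_mpolyC mevalC; congr (_ * _).
by apply: mmap1_eq => i; rewrite /= map_mpolyX mevalXU.
Qed.

Lemma mmap_binom n (v : 'I_n -> L) (a b : 'X_{1..n}) :
  mmap iota v (binom K a b) = \prod_i v i ^+ a i - \prod_i v i ^+ b i.
Proof. by rewrite rmorphB /= !mmapX. Qed.

Lemma mmap_ext n (v w : 'I_n -> L) (f : {mpoly K[n]}) :
  v =1 w -> mmap iota v f = mmap iota w f.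
Proof. by move=> vw; apply: eq_bigr => u _; rewrite (mmap1_eq _ vw). Qed.

Lemma mmap_phi l n (N : 'M[int]_(l, n)) (T : 'I_l -> L) (f : {mpoly K[n]}) :
  mmap iota T (phi N f) = mmap iota (fun i => \prod_j T j ^+ absz (N j i)) f.
Proof.
rewrite /phi; set lq := [tuple _ | _ < n].
rewrite -[LHS]/((mmap iota T \o comp_mpoly lq) f) [LHS]rmorph_mpolyE.
apply: eq_bigr => u _ /=; rewrite comp_mpolyC [mmap _ _ _]mmapC; congr (_ * _).
apply: mmap1_eq => i; rewrite /= comp_mpolyXU -tnth_nth tnth_mktuple mmapX.
by apply: eq_bigr => j _; rewrite mnmE.
Qed.

Section ToricIdeal.
Variables (m n : nat) (M : 'M[int]_(m, n)).

Lemma toric_is_ideal : is_ideal (@toric_ideal K m n M).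
Proof.
split=> [|f g|f g].
- by apply/(toric_idealP iota) => T T0; rewrite rmorph0.
- move=> /(toric_idealP iota) Mf /(toric_idealP iota) Mg.
  by apply/(toric_idealP iota) => T T0; rewrite rmorphD /= Mf // Mg // addr0.
- move=> /(toric_idealP iota) Mg.
  by apply/(toric_idealP iota) => T T0; rewrite rmorphM /= Mg // mulr0.
Qed.

Lemma toric_radical (f : {mpoly K[n]}) k :
  toric_ideal M (f ^+ k) -> toric_ideal M f.
Proof.
move=> /(toric_idealP iota) Mf; apply/(toric_idealP iota) => T T0.
by have /eqP := Mf T T0; rewrite rmorphXn expf_eq0 => /andP[_ /eqP].
Qed.

(** From left to right, the Laurent monomial of exponent M(a - b) is 1 on the whole torus, so
    [tpow_dual0] applies. *)
Lemma toric_binomP (a b : 'X_{1..n}) :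
  toric_ideal M (binom K a b) <-> M *m mexpZ a = M *m mexpZ b.
Proof.
have E (T : 'I_m -> L) : (forall j, T j != 0) ->
    mmap iota (fun i => tpow T (col i M)) (binom K a b)
    = tpow T (M *m mexpZ a) - tpow T (M *m mexpZ b).
  by move=> T0; rewrite mmap_binom !tpow_mul // !tpow_mexpZ.
split=> [/(toric_idealP iota) Mab|Mab].
  apply/eqP; rewrite -subr_eq0; apply/eqP/(@tpow_dual0 L) => T T0.
  have /eqP := Mab T T0; rewrite E // subr_eq0 tpowD // tpowN // => /eqP->.
  by rewrite mulfV // tpow_neq0.
by apply/(toric_idealP iota) => T T0; rewrite E // Mab subrr.
Qed.

End ToricIdeal.

(** * The criterion, on the torus and on its boundary *)

Section Criterion.
Variables (m n l : nat) (M : 'M[int]_(m, n)) (N : 'M[int]_(l, n)).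
Hypothesis N_nonneg : forall (j : 'I_l) (i : 'I_n), 0 <= N j i.
Hypothesis IN_sub_IM : forall f : {mpoly K[n]}, toric_ideal N f -> toric_ideal M f.
Hypothesis Gamma_V : same_set (Gamma N) (zero_set iota (@toric_ideal K l n N)).
Variables (s : nat) (u v : 'I_s -> 'X_{1..n}).
Hypothesis f_in_IM : forall k : 'I_s, toric_ideal M (@binom K n (u k) (v k)).

Let J (f : {mpoly K[n]}) : Prop := exists k : 'I_s, f = binom K (u k) (v k).

Let phiJ (g : {mpoly K[l]}) : Prop := exists k : 'I_s, g = phi N (binom K (u k) (v k)).

Let phiIM (g : {mpoly K[l]}) : Prop := exists f, toric_ideal M f /\ g = phi N f.

(** [Gamma_V] parametrizes the zeros of I_N by [T]. That I_M contains the radical holds in any case,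
    I_M being radical and containing the generators. *)
Lemma IM_eq_radIP :
  same_set (@toric_ideal K m n M)
    (radI (ideal_gen (setU_P (@toric_ideal K l n N) J)))
  <-> (forall T : 'I_l -> L, vanishes T phiJ -> vanishes T phiIM).
Proof.
split=> [IM_eq T TJ _ [f [Mf ->]]|zeros f].
  rewrite mmap_phi; have /IM_eq := Mf; apply: radI_vanishes => g [Ng|[k ->]].
    have /Gamma_V/(_ g Ng) : Gamma N (fun i => \prod_j T j ^+ absz (N j i)).
      by exists T.
    by rewrite meval_map_mpoly.
  by rewrite -mmap_phi; apply: TJ; exists k.
split=> [Mf|[k]].
  apply: (@nullstellensatz _ L iota) => x xNJ.
  have /Gamma_V[T Tx] : zero_set iota (@toric_ideal K l n N) x.
    by move=> g Ng; rewrite meval_map_mpoly; apply: xNJ; left.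
  rewrite (mmap_ext _ Tx) -mmap_phi; apply: (zeros T); last by exists f.
  by move=> _ [k ->]; rewrite mmap_phi -(mmap_ext _ Tx); apply: xNJ; right; exists k.
move=> fk; apply: (toric_radical (k := k)); move: fk.
apply: ideal_gen_min => [|g [/IN_sub_IM//|[i ->//]]].
exact: toric_is_ideal.
Qed.

Lemma phiJ_phiIM g : phiJ g -> phiIM g.
Proof. by case=> k ->; exists (binom K (u k) (v k)). Qed.

(** Adjoining ['X_i] restricts the zeros to T i = 0. One of the two inclusions is automatic by
    [phiJ_phiIM]. *)
Lemma cond_bP :
  (forall i : 'I_l, same_set
     (radI (ideal_gen (setU_P phiIM (fun g => g = 'X_i))))
     (radI (ideal_gen (setU_P phiJ (fun g => g = 'X_i)))))
  <-> (forall T i, T i = 0 -> vanishes T phiJ -> vanishes T phiIM).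
Proof.
have XT (T : 'I_l -> L) i : mmap iota T 'X_i = T i by rewrite mmapX mmap1U.
split=> [cb T i Ti0 TJ g IMg|zeros i f].
  have /cb : radI (ideal_gen (setU_P phiIM (fun g => g = 'X_i))) g.
    by exists 1%N; rewrite expr1; apply: ideal_gen_incl; left.
  by apply: radI_vanishes => h [/TJ//|->]; rewrite XT.
split; apply: radI_gen_sub => T Tv g [Sg|->].
- apply: (zeros T i) Sg; first by rewrite -XT; apply: Tv; right.
  by move=> h Jh; apply: Tv; left.
- by apply: Tv; right.
- by apply: Tv; left; apply: phiJ_phiIM.
- by apply: Tv; right.
Qed.

Lemma mmap_phi_torus (T : 'I_l -> L) f : (forall j, T j != 0) ->
  mmap iota T (phi N f) = mmap iota (fun i => tpow T (col i N)) f.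
Proof.
move=> T0; rewrite mmap_phi; apply: mmap_ext => i; apply: eq_bigr => j _.
by rewrite mxE -[in RHS](gez0_abs (N_nonneg j i)).
Qed.

Lemma mmap_phi_binom (T : 'I_l -> L) a b : (forall j, T j != 0) ->
  mmap iota T (phi N (binom K a b)) = 0 <-> tpow T (N *m hatb a b) = 1.
Proof.
move=> T0; rewrite mmap_phi_torus // mmap_binom -!tpow_mexpZ -!tpow_mul //.
rewrite /hatb mulmxBr tpowD // tpowN //.
have t0 := tpow_neq0 T0 (N *m mexpZ b).
split=> [/eqP|/(divr1_eq) ->]; last by rewrite subrr.
by rewrite subr_eq0 => /eqP->; rewrite mulfV.
Qed.

(** A kernel vector is the difference of its positive and negative parts, hence comes from a
    binomial of I_M. Conversely, triviality makes T^(N u) depend on M u only. *)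
Lemma vanishes_phiIM_torusP (T : 'I_l -> L) : (forall j, T j != 0) ->
  vanishes T phiIM <-> (forall y, NkerM M N y -> tpow T y = 1).
Proof.
move=> T0; split=> [TIM y [w [Mw ->]]|TN _ [f [Mf ->]]].
  pose a : 'X_{1..n} := [multinom absz (Num.max (w i 0) 0)%R | i < n].
  pose b : 'X_{1..n} := [multinom absz (Num.max (- w i 0) 0)%R | i < n].
  have Dw : w = hatb a b.
    apply/colP => i; rewrite !mxE !mnmE.
    by move: (w i 0) => z; lia.
  rewrite Dw; apply/mmap_phi_binom => //; apply: TIM; exists (binom K a b).
  split=> //; apply/toric_binomP/eqP; rewrite -subr_eq0 -mulmxBr.
  by rewrite -[_ - _]/(hatb a b) -Dw Mw.
rewrite mmap_phi_torus // mmap_torus //; apply: (toric_ideal_sum0 iota Mf).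
move=> a b Mab; have : tpow T (N *m hatb a b) = 1.
  by apply: TN; exists (hatb a b); rewrite mulmxBr Mab subrr.
by rewrite /hatb mulmxBr tpowD // tpowN // => /divr1_eq.
Qed.

Variable e : nat.
Hypothesis e_part : forall d, (0 < d)%N ->
  exists k d', d = (e ^ k * d')%N /\ d'%:R != 0 :> L.
Hypothesis e_root : forall (x : L) k, x ^+ (e ^ k) = 1 -> x = 1.

Let G : 'cV[int]_l -> Prop := Zspan (fun k : 'I_s => N *m hatb (u k) (v k)).

(** One direction is [tpow_dual] for the matrix [B] of generators of [G]. For the other, a character
    trivial on [G] takes at [y] a value whose e^k-th power is 1, hence the value 1 by [e_root]. *)
Lemma torus_condP :
  (forall T, (forall j, T j != 0) -> vanishes T phiJ -> vanishes T phiIM)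
  <-> exists k : nat, forall y, NkerM M N y -> G ((e ^ k)%:Z *: y).
Proof.
have TJP (T : 'I_l -> L) : (forall j, T j != 0) -> vanishes T phiJ <->
    forall k, tpow T (N *m hatb (u k) (v k)) = 1.
  move=> T0; split=> [TJ k|TG _ [k ->]]; last exact/mmap_phi_binom.
  by apply/mmap_phi_binom => //; apply: TJ; exists k.
split=> [zeros|[k NG] T T0 /(TJP T T0) TG].
  pose B := \matrix_(j < l, k < s) (N *m hatb (u k) (v k)) j 0.
  have colB k : col k B = N *m hatb (u k) (v k).
    by apply/colP => j; rewrite mxE [B _ _]mxE.
  have [k kP] := tpow_dual e_part B; exists k => y Ny.
  have [|c ->] := kP y.
    move=> T T0 TB; have : vanishes T phiIM.
      by apply: zeros => //; apply/TJP => // i; rewrite -colB.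
    by move/vanishes_phiIM_torusP; apply.
  exists (fun i => c i 0); apply/colP => j; rewrite mxE summxE.
  by apply: eq_bigr => i _; rewrite [B _ _]mxE [in RHS]mxE mulrC.
apply/vanishes_phiIM_torusP => // y /NG[c Dy]; apply: (@e_root _ k).
rewrite exprnP -tpowZ // Dy tpow_sum // big1 // => i _.
by rewrite tpowZ // TG exp1rz.
Qed.

Lemma IM_eqP :
  same_set (@toric_ideal K m n M)
    (radI (ideal_gen (setU_P (@toric_ideal K l n N) J)))
  <-> (exists k : nat, forall y, NkerM M N y -> G ((e ^ k)%:Z *: y)) /\
    (forall i : 'I_l, same_set
       (radI (ideal_gen (setU_P phiIM (fun g => g = 'X_i))))
       (radI (ideal_gen (setU_P phiJ (fun g => g = 'X_i))))).
Proof.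
rewrite IM_eq_radIP cond_bP -torus_condP.
split=> [zeros|[torus boundary] T]; first by split=> T *; apply: zeros.
have [/forallP T0|] := boolP [forall j, T j != 0]; first exact: torus.
by rewrite negb_forall => /existsP[i /negPn/eqP Ti]; apply: boundary Ti.
Qed.

(** This inclusion makes condition (a) an equality in characteristic 0. *)
Lemma Zspan_sub_NkerM y : G y -> NkerM M N y.
Proof.
case=> c ->; exists (\sum_k c k *: hatb (u k) (v k)); split.
  rewrite mulmx_sumr big1 // => k _; rewrite -scalemxAr mulmxBr.
  by have /toric_binomP -> := f_in_IM k; rewrite subrr scaler0.
by rewrite mulmx_sumr; apply: eq_bigr => k _; rewrite -scalemxAr.
Qed.

End Criterion.
End ZeroSets.

Theorem theorem4p4
  (K : fieldType) (L : closedFieldType) (iota : {rmorphism K -> L})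
  (L_alg : forall x : L, exists p : {poly K}, p != 0 /\ root (map_poly iota p) x)
  (m n l : nat) (M : 'M[int]_(m, n)) (N : 'M[int]_(l, n))
  (N_nonneg : forall (j : 'I_l) (i : 'I_n), 0 <= N j i)
  (N_col_nz : forall i : 'I_n, exists j : 'I_l, N j i != 0)
  (IN_sub_IM : forall f : {mpoly K[n]}, toric_ideal N f -> toric_ideal M f)
  (Gamma_V : same_set (Gamma N) (zero_set iota (@toric_ideal K l n N)))
  (s : nat) (u v : 'I_s -> 'X_{1..n})
  (f_in_IM : forall k : 'I_s, toric_ideal M (@binom K n (u k) (v k))) :
  let J : {mpoly K[n]} -> Prop := fun f => exists k : 'I_s, f = @binom K n (u k) (v k) in
  let G : 'cV[int]_l -> Prop := Zspan (fun k : 'I_s => N *m hatb (u k) (v k)) in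
  let IM_eq : Prop :=
    same_set (@toric_ideal K m n M) (radI (ideal_gen (setU_P (@toric_ideal K l n N) J))) in
  let cond_b : Prop :=
    forall i : 'I_l,
      same_set
        (radI (ideal_gen (setU_P (fun g => exists f, toric_ideal M f /\ g = phi N f)
                                (fun g => g = 'X_i))))
        (radI (ideal_gen (setU_P (fun g => exists k : 'I_s, g = phi N (@binom K n (u k) (v k)))
                                (fun g => g = 'X_i)))) in
  (forall p : nat, p \in [pchar K] ->
     (IM_eq <-> ((exists k : nat, forall y, NkerM M N y -> G ((p ^ k)%:Z *: y)) /\ cond_b)))
  /\
  ([pchar K] =i pred0 -> (IM_eq <-> (same_set (NkerM M N) G /\ cond_b))).
Proof.
move=> J G IM_eq cond_b; split=> [p pK|K0].
  have pL : p \in [pchar L] by rewrite (fmorph_pchar iota).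
  have pr_p := pcharf_prime pL.
  apply: (IM_eqP N_nonneg IN_sub_IM Gamma_V f_in_IM) => [d d0|x k].
    (* The p-part of [d] and its prime-to-p part. *)
    exists (logn p d), (d`_p^')%N; rewrite -p_part partnC //; split=> //.
    by rewrite -(dvdn_pcharf pL) -p'natE // part_pnat.
  (* Frobenius is injective, so 1 is the only root of unity of p-power order. *)
  elim: k => [|k IH]; first by rewrite expr1.
  rewrite expnSr exprM -(pFrobenius_autE pL) => /eqP.
  by rewrite -[X in _ == X](rmorph1 (pFrobenius_aut pL)) (inj_eq (fmorph_inj _))
    => /eqP/IH.
(* In characteristic 0 the criterion is applied with e = 1. *)
have -> : same_set (NkerM M N) G
    <-> exists k : nat, forall y, NkerM M N y -> G ((1 ^ k)%:Z *: y).
  split=> [NG|[k NG] y]; first by exists 0%N => y /NG; rewrite scale1r.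
  by split=> [/NG|/(Zspan_sub_NkerM iota f_in_IM)//]; rewrite exp1n scale1r.
apply: (IM_eqP N_nonneg IN_sub_IM Gamma_V f_in_IM) => [d d0|x k].
  exists 0%N, d; rewrite mul1n; split=> //.
  have /pcharf0P -> : [pchar L] =i pred0 by move=> q; rewrite (fmorph_pchar iota).
  by rewrite -lt0n.
by rewrite exp1n expr1.
Qed.
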